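(* Let $1<c<4/3$. Then the sequence $(u_n)_{n\geq 1}$ defined by $u_n=\mathbf t\left(\lfloor n^c\rfloor\right)$ is normal; that is, for every integer $T\geq 1$ and every $(\varepsilon_0,\ldots,\varepsilon_{T-1})\in\{0,1\}^T$, \[ \lim_{N\to\infty}\frac1N\left|\left\{1\leq n\leq N:\ u_{n+j}=\varepsilon_j\text{ for all }0\leq j<T\right\}\right|=2^{-T}. \]
   Context: For a nonnegative integer $n$, $s(n)$ denotes the number of $1$'s in the binary representation of $n$ (the binary sum-of-digits function). The Thue--Morse sequence is $\mathbf t(n)=s(n)\bmod 2\in\{0,1\}$. $\lfloor x\rfloor$ denotes the integer part of $x$. *)

(* Defs.v *)
From HB Require Import structures.
From mathcomp Require Import all_boot all_order all_algebra.
From mathcomp Require Import all_classical all_reals all_analysis.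

Set Implicit Arguments.
Unset Strict Implicit.
Unset Printing Implicit Defensive.

Import Order.TTheory GRing.Theory Num.Theory.
Import numFieldNormedType.Exports.

Local Open Scope classical_set_scope.
Local Open Scope ring_scope.

(* Least significant digit first, without leading zeros: up_log 2 n.+1 is the
   least e with n < 2 ^ e, so that 0 has the empty expansion. *)
Definition binary_digits (n : nat) : seq bool :=
  mkseq (fun i => odd (n %/ 2 ^ i)%N) (up_log 2 n.+1).

Definition sum_binary_digits (n : nat) : nat := count_mem true (binary_digits n).

Definition thue_morse (n : nat) : 'I_2 :=
  Ordinal (ltn_pmod (sum_binary_digits n) (isT : 0 < 2)%N).

(* The sequence is indexed from 1: the value u 0 is never used. *)
Definition block_count (u : nat -> 'I_2) (T : nat) (eps : 'I_T -> 'I_2)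
    (N : nat) : nat :=
  #|[set n : 'I_N.+1 | (1 <= n)%N && [forall j : 'I_T, u (n + j)%N == eps j]]%SET|.

Definition normal_seq (R : realType) (u : nat -> 'I_2) : Prop :=
  forall (T : nat) (eps : 'I_T -> 'I_2), (1 <= T)%N ->
    ((block_count u eps N)%:R / N%:R : R) @[N --> \oo] --> (2 ^- T : R).

(* For x >= 0, Num.truncn x is the integer part of x, as a natural number. *)
Definition thue_morse_ps (R : realType) (c : R) (n : nat) : 'I_2 :=
  thue_morse (Num.truncn (n%:R `^ c)).

(* Main.v *)
(* For a nonempty finite set J of shifts, the sign (-1) ^ (sum of
   s(floor((n + j) ^ c)), j in J) has mean 0; by Fourier inversion on
   (Z/2)^T this is normality. On a window of length P = 2 ^ (nu + l + m),
   with 2 ^ nu of the order of N ^ (c - 1), n ^ c is linear up to an error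
   O(P ^ 2 * N ^ (c - 2)) = O(N ^ (3c - 4)) = o(1). Average the sign over Q
   consecutive shifts: since Q steps move n ^ c by much less than
   2 ^ (nu + l), the digits beyond nu + l contribute the same sign to all
   shifts (barring rare carries), and the absolute value of the average only
   depends on n ^ c mod 2 ^ (nu + l) and on the slope, each known to
   precision 2 ^ -m. For most n the points of the window hit every residue
   class a bounded number of times, because two visits at distance h force h
   times the slope to be near a multiple of P, which is rare on average. As
   the averages are nonnegative, this upper bound suffices to replace them
   by their mean over all residues X and slopes A. There Cauchy-Schwarz
   leads to correlations of the signs of X + d * A for d in a fixed list,
   which decay exponentially: reading the digits of X and A from the low
   end, whatever the carries are, two choices of a bounded number of digits
   clear all carries with opposite signs. *)

Require Import Defs.
From mathcomp Require Import all_boot all_order all_algebra.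
From mathcomp Require Import all_classical all_reals all_analysis.
From mathcomp Require Import zify ring lra.

Set Implicit Arguments.
Unset Strict Implicit.
Unset Printing Implicit Defensive.

Import Order.TTheory GRing.Theory Num.Theory.
Import numFieldNormedType.Exports.

Local Open Scope ring_scope.

(** * Thue-Morse signs and their correlations *)

(** The digits added beyond the expansion are 0. A common length [e] is what allows digit sums of
    different numbers to be compared position by position. *)
Lemma sum_binary_digits_widen e n : (n < 2 ^ e)%N ->
  sum_binary_digits n = (\sum_(i < e) odd (n %/ 2 ^ i))%N.
Proof.
move=> ne; have e0e : (up_log 2 n.+1 <= e)%N by apply: up_log_min.
have ne0 : (n < 2 ^ up_log 2 n.+1)%N by apply: up_logP.
rewrite /sum_binary_digits /binary_digits /mkseq count_map -sum1_count.
rewrite big_mkcond /= -[X in iota 0 X]subn0 -/(index_iota _ _).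
rewrite -(big_mkord xpredT (fun i => odd (n %/ 2 ^ i) : nat)).
rewrite [RHS](big_cat_nat (n := up_log 2 n.+1))//=.
rewrite [X in (_ + X)%N]big_nat [X in (_ + X)%N]big1 => [|i /andP[i1 _]].
  by rewrite addn0; apply: eq_bigr => i _; case: odd.
by rewrite divn_small// (leq_trans ne0)// leq_pexp2l.
Qed.

Lemma sum_binary_digits_split b q r : (r < 2 ^ b)%N ->
  sum_binary_digits (2 ^ b * q + r) =
  (sum_binary_digits q + sum_binary_digits r)%N.
Proof.
move=> rb; have qe : (q < 2 ^ q)%N by rewrite ltn_expl.
have be : (2 ^ b * q + r < 2 ^ (b + q))%N.
  rewrite expnD; apply: (@leq_trans (2 ^ b * q.+1)); first by rewrite mulnS; lia.
  by rewrite leq_mul2l qe orbT.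
rewrite (sum_binary_digits_widen be) (sum_binary_digits_widen rb).
rewrite (sum_binary_digits_widen qe) big_split_ord /= addnC; congr addn.
  apply: eq_bigr => i _; rewrite expnD divnMA [(2 ^ b * q)%N]mulnC.
  by rewrite divnMDl ?expn_gt0// (divn_small rb) addn0.
apply: eq_bigr => i _; have ib := ltn_ord i.
have -> : (2 ^ b * q = (q * 2 ^ (b - i.+1)).*2 * 2 ^ i)%N.
  rewrite -muln2 -!mulnA mulnC -expnS -expnD; congr (_ * 2 ^ _)%N; lia.
by rewrite divnMDl ?expn_gt0// oddD odd_double.
Qed.

(** The bound [M] on carries reproduces itself: with [B = 2 ^ b], the sum is at most [(B - 1) + M *
    (B - 1) + M = (M + 1) * B - 1]. *)
Lemma carry_bound M b x a d (i : nat -> nat) : (x < 2 ^ b)%N -> (a < 2 ^ b)%N ->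
  (d <= M)%N -> (i d <= M)%N -> ((x + d * a + i d) %/ 2 ^ b <= M)%N.
Proof.
move=> xb ab dM iM; rewrite -ltnS ltn_divLR ?expn_gt0//.
have : (d * a <= M * (2 ^ b).-1)%N by apply: leq_mul => //; lia.
by case: (2 ^ b)%N xb ab => // B; nia.
Qed.

Section Sign.
Variable R : realType.

Definition tm_sign (n : nat) : R := (-1) ^+ sum_binary_digits n.

Lemma tm_sign_split b q r : (r < 2 ^ b)%N ->
  tm_sign (2 ^ b * q + r) = tm_sign q * tm_sign r.
Proof. by move=> rb; rewrite /tm_sign sum_binary_digits_split// exprD. Qed.

Lemma tm_sign_divn b n :
  tm_sign n = tm_sign (n %/ 2 ^ b) * tm_sign (n %% 2 ^ b).
Proof.
by rewrite {1}(divn_eq n (2 ^ b)) mulnC tm_sign_split// ltn_pmod// expn_gt0.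
Qed.

Lemma tm_sign_sqr n : tm_sign n * tm_sign n = 1.
Proof. by rewrite /tm_sign -expr2 sqrr_sign. Qed.

Lemma norm_tm_sign n : `|tm_sign n| = 1.
Proof. by rewrite /tm_sign normrX normrN1 expr1n. Qed.

Lemma norm_prod_tm_sign (T : eqType) (s : seq T) (h : T -> nat) :
  `|\prod_(d <- s) tm_sign (h d)| = 1.
Proof. by rewrite normr_prod big1// => d _; rewrite norm_tm_sign. Qed.

Lemma tm_sign_pow2 k : tm_sign (2 ^ k) = -1.
Proof.
have : (0 < 2 ^ k)%N by rewrite expn_gt0.
move/(tm_sign_split 1); rewrite muln1 addn0 => ->.
by rewrite /tm_sign /sum_binary_digits /= mulr1.
Qed.

Lemma sum_nat_mulD (V : nmodType) m n (F : nat -> V) :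
  \sum_(0 <= x < m * n) F x = \sum_(0 <= i < m) \sum_(0 <= j < n) F (i + m * j)%N.
Proof.
rewrite exchange_big /=; elim: n => [|n IH]; first by rewrite muln0 !big_geq.
rewrite mulnS addnC (big_cat_nat (n := (m * n)%N)) ?leq_addr//= IH.
rewrite big_nat_recr//=; congr (_ + _).
rewrite -[X in index_iota X _]add0n big_addn addnC addnK.
by [].
Qed.

Section Cancellation.
Variables (ds : seq nat) (M : nat).
Hypotheses (dsM : {in ds, forall d, d <= M}%N) (uM : count_mem M ds = 1%N).
Hypothesis (even_ds : ~~ odd (size ds)).

(* The argument [2 ^ k.+1 - M + d] has one digit 1 more than [2 ^ k - M + d]
   unless [d = M], when both are powers of 2. *)
Lemma prod_tm_sign_opp k : (M <= 2 ^ k)%N ->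
  \prod_(d <- ds) tm_sign (2 ^ k.+1 - M + d) =
  - \prod_(d <- ds) tm_sign (2 ^ k - M + d).
Proof.
move=> Mk.
have E d : d \in ds -> tm_sign (2 ^ k.+1 - M + d) =
    (-1) ^+ (d != M) * tm_sign (2 ^ k - M + d).
  move=> /dsM dM; have [->|dneM] /= := eqVneq d M.
    by rewrite !subnK ?mul1r ?tm_sign_pow2// expnS; lia.
  rewrite expr1.
  have -> : (2 ^ k.+1 - M + d = 2 ^ k * 1 + (2 ^ k - M + d))%N.
    by rewrite expnS; lia.
  rewrite tm_sign_split; last by lia.
  by rewrite -[1%N]/(2 ^ 0)%N tm_sign_pow2.
rewrite (eq_big_seq _ E) big_split /= -[RHS]mulN1r; congr (_ * _).
rewrite -(big_morph _ (@exprD R (-1)) (expr0 _)).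
have -> : (\sum_(d <- ds) (d != M) = count (predC (pred1 M)) ds)%N.
  by rewrite -sum1_count [RHS]big_mkcond /=; apply: eq_bigr => d _; case: eqP.
(* An odd number of factors changes sign: [size ds] is even and [M] occurs once. *)
have := count_predC (pred1 M) ds; rewrite uM => h.
by rewrite -signr_odd; move: even_ds; rewrite -h /= negbK => ->.
Qed.

(** Here [i d] is the carry coming from lower digits that are already fixed, and [theta] is the part
    of the first variable above the [nu] digits that it shares with the second. *)
Definition carry_sum (nu theta : nat) (i : nat -> nat) : R :=
  \sum_(0 <= x < 2 ^ nu) \sum_(0 <= a < 2 ^ nu)
    \prod_(d <- ds) tm_sign (x + d * a + i d + 2 ^ nu * theta).

Lemma carry_sum_trivial nu theta i : `|carry_sum nu theta i| <= (4 ^ nu)%:R.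
Proof.
rewrite /carry_sum (le_trans (ler_norm_sum _ _ _))//.
apply: (@le_trans _ _ (\sum_(0 <= x < 2 ^ nu) (2 ^ nu)%:R)).
  apply: ler_sum => x _; rewrite (le_trans (ler_norm_sum _ _ _))//.
  rewrite (eq_bigr (fun=> 1)) => [|a _]; last by rewrite norm_prod_tm_sign.
  by rewrite big_const_nat iter_addr subn0 addr0.
by rewrite big_const_nat iter_addr subn0 addr0 -mulrnA -expnMn.
Qed.

(** The [b] low digits of [x] and [a] are read first: their signs factor out, and the quotients by
    [2 ^ b] are the carries into the remaining [nu] digits. *)
Lemma carry_sum_rec b nu theta i :
  carry_sum (b + nu) theta i =
  \sum_(0 <= x < 2 ^ b) \sum_(0 <= a < 2 ^ b)
    (\prod_(d <- ds) tm_sign ((x + d * a + i d) %% 2 ^ b)) *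
    carry_sum nu theta (fun d => (x + d * a + i d) %/ 2 ^ b)%N.
Proof.
rewrite /carry_sum expnD sum_nat_mulD; apply: eq_bigr => x0 _.
under eq_bigr do rewrite sum_nat_mulD.
rewrite exchange_big /=; apply: eq_bigr => a0 _.
rewrite mulr_sumr; apply: eq_bigr => x1 _.
rewrite mulr_sumr; apply: eq_bigr => a1 _.
rewrite -big_split; apply: eq_bigr => d _ /=.
have -> : (x0 + 2 ^ b * x1 + d * (a0 + 2 ^ b * a1) + i d + 2 ^ b * 2 ^ nu * theta
   = 2 ^ b * (x1 + d * a1 + 2 ^ nu * theta) + (x0 + d * a0 + i d))%N by nia.
rewrite (tm_sign_divn b) mulrC mulnC modnMDl divnMDl ?expn_gt0//.
by congr (_ * tm_sign _); lia.
Qed.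

Lemma eq_carry_sum nu theta i j : {in ds, i =1 j} ->
  carry_sum nu theta i = carry_sum nu theta j.
Proof.
move=> ij; apply: eq_bigr => x _; apply: eq_bigr => a _.
by apply: eq_big_seq => d /ij ->.
Qed.

(* Two choices of the [b] low digits of [(x, a)] end with all carries equal
   to 0 but with opposite signs, whatever the incoming carries. *)
Lemma carry_sum_contract q r theta i : {in ds, forall d, i d <= M}%N ->
  `|carry_sum ((M + M.+2) * q + r) theta i|
    <= ((4 ^ (M + M.+2))%:R - 2) ^+ q * (4 ^ r)%:R.
Proof.
move=> iM; set b := (M + M.+2)%N; elim: q i iM => [|q IH] i iM.
  by rewrite muln0 add0n expr0 mul1r carry_sum_trivial.
have M2 : (M < 2 ^ M)%N by rewrite ltn_expl.
have b2 : (2 ^ b = 2 ^ M * (2 ^ M * 4))%N by rewrite /b expnD !expnS; lia.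
set C : R := ((4 ^ b)%:R - 2) ^+ q * (4 ^ r)%:R.
rewrite mulnS -addnA carry_sum_rec big_mkord.
under eq_bigr do rewrite big_mkord.
rewrite pair_big /=; set G := BIG_F.
have Gle p : `|G p| <= C.
  rewrite /G normrM norm_prod_tm_sign mul1r; apply: IH => d dds.
  by apply: carry_bound => //; [exact: dsM|exact: iM].
(* For [x = 2 ^ M * (2 ^ (M + j) - M)] and [a = 2 ^ M], the argument is
   [2 ^ M * (2 ^ (M + j) - M + d) + i d]. The incoming carry, at most [M < 2 ^ M], stays in the [M]
   lowest digits, and the total stays below [2 ^ b]. *)
have xlt (j : 'I_2) : (2 ^ M * (2 ^ (M + j) - M) < 2 ^ b)%N.
  rewrite b2 ltn_pmul2l ?expn_gt0// (@leq_ltn_trans (2 ^ (M + j)))//.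
    by rewrite leq_subr.
  by rewrite expnD ltn_pmul2l ?expn_gt0//; case: j => -[|[]].
have alt : (2 ^ M < 2 ^ b)%N by rewrite b2 -{1}[(2 ^ M)%N]muln1 ltn_pmul2l; lia.
pose p j : 'I_(2 ^ b) * 'I_(2 ^ b) := (Ordinal (xlt j), Ordinal alt).
have GpE j : G (p j) = (\prod_(d <- ds) tm_sign (i d)) *
    \prod_(d <- ds) tm_sign (2 ^ (M + j) - M + d) *
    carry_sum (b * q + r) theta (fun=> 0%N).
  have E d : d \in ds -> (2 ^ M * (2 ^ (M + j) - M) + d * 2 ^ M + i d
      = 2 ^ M * (2 ^ (M + j) - M + d) + i d)%N by move=> _; lia.
  have lt d : d \in ds -> (2 ^ M * (2 ^ (M + j) - M + d) + i d < 2 ^ b)%N.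
    move=> dds; have := iM _ dds; have := dsM dds; rewrite b2.
    have : (2 ^ (M + j) <= 2 ^ M * 2)%N.
      by rewrite expnD leq_pmul2l ?expn_gt0//; case: (j) => -[|[]].
    by move: (2 ^ (M + j))%N => y; nia.
  rewrite /G /= -big_split /=; congr (_ * _).
    apply: eq_big_seq => d dds; rewrite E// modn_small ?lt// mulrC.
    by rewrite tm_sign_split// (leq_ltn_trans (iM _ dds)).
  by apply: eq_carry_sum => d dds; rewrite E// divn_small ?lt.
pose j0 : 'I_2 := Ordinal (isT : (0 < 2)%N).
pose j1 : 'I_2 := Ordinal (isT : (1 < 2)%N).
have Gp0 : G (p j0) + G (p j1) = 0.
  rewrite !GpE addn0 addn1 prod_tm_sign_opp; last exact: ltnW.
  by rewrite mulrN mulNr addrN.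
have p10 : p j1 != p j0.
  rewrite xpair_eqE negb_and -val_eqE /= addn1 addn0 expnS.
  by rewrite eqn_pmul2l ?expn_gt0//; lia.
have sumC : \sum_(x | (x != p j0) && (x != p j1)) C = ((4 ^ b)%:R - 2) * C.
  have : \sum_(x : 'I_(2 ^ b) * 'I_(2 ^ b)) C = (4 ^ b)%:R * C.
    rewrite sumr_const card_prod card_ord -expnMn.
    by rewrite mulr_natl.
  rewrite (bigD1 (p j0))//= (bigD1 (p j1))//= => h.
  by rewrite mulrBl -h; ring.
(* The two opposite terms cancel; the induction hypothesis bounds the [4 ^ b - 2] others. *)
rewrite (bigD1 (p j0))//= (bigD1 (p j1))//= addrA Gp0 add0r.
rewrite (le_trans (ler_norm_sum _ _ _))// exprS -mulrA -sumC.
by apply: ler_sum => x _.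
Qed.

End Cancellation.
End Sign.

(** * Correlations of shifted sign products and their averages *)

Section Correlation.
Variable R : realType.

(* The [m] low digits of [z] play the role of a fractional part. *)
Definition shift_prod (m : nat) (js : seq nat) (r X A : nat) : R :=
  \prod_(j <- js) tm_sign R ((X + (r + j) * A) %/ 2 ^ m).

(** Fix the [m] low digits of [X] and [A], which only supply initial carries at most [M], and the
    [l] top digits of [X], which form [theta]. What remains is a [carry_sum], whose contraction is
    uniform in these data. *)
Lemma correlation_small (ds : seq nat) (M : nat) (e : R) :
  {in ds, forall d, d <= M}%N -> count_mem M ds = 1%N -> ~~ odd (size ds) ->
  0 < e ->
  exists nu0, forall nu m l, (nu0 <= nu)%N ->
   `|\sum_(0 <= X < 2 ^ (m + (nu + l))) \sum_(0 <= A < 2 ^ (m + nu))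
      \prod_(d <- ds) tm_sign R ((X + d * A) %/ 2 ^ m)|
   <= e * (2 ^ (m + (nu + l)))%:R * (2 ^ (m + nu))%:R.
Proof.
move=> dsM uM evds e0; have [b bE] : exists b, b = (M + M.+2)%N by exists (M + M.+2)%N.
have B0 : 0 < (4 ^ b)%:R :> R by rewrite ltr0n expn_gt0.
have B2 : 2 <= (4 ^ b)%:R :> R.
  by rewrite ler_nat bE addnS expnS; have := expn_gt0 4 (M + M.+1); lia.
set rho : R := ((4 ^ b)%:R - 2) / (4 ^ b)%:R.
have rho_ge0 : 0 <= rho by rewrite divr_ge0 ?subr_ge0// ltW.
have rho_lt1 : rho < 1 by rewrite ltr_pdivrMr// mul1r ltrBlDr ltrDl.
have [q0 hq0] : exists q0, rho ^+ q0 <= e.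
  have /cvgrPdist_le/(_ e e0)[q0 _ hq] : (rho ^+ n @[n --> \oo] --> (0 : R))%classic.
    by apply: cvg_expr; rewrite ger0_norm.
  exists q0; have := hq q0 (leqnn q0).
  by rewrite /= sub0r normrN ger0_norm// exprn_ge0.
(* Each block of [b] digits gains a factor [rho], and [q0] blocks suffice. *)
exists (b * q0)%N => nu m l nu0.
have Snu theta i : {in ds, forall d, i d <= M}%N ->
    `|carry_sum R ds nu theta i| <= e * (4 ^ nu)%:R.
  move=> iM; have := carry_sum_contract R dsM uM evds (nu %/ b) (nu %% b) theta iM.
  rewrite -bE [(b * _)%N]mulnC -divn_eq => h; apply: le_trans h _.
  have -> : (4 ^ nu = 4 ^ (b * (nu %/ b) + nu %% b))%N by rewrite mulnC -divn_eq.
  rewrite expnD natrM mulrA ler_wpM2r// expnM [X in _ <= _ * X]natrX.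
  have -> : (4 ^ b)%:R - 2 = rho * (4 ^ b)%:R :> R by rewrite divfK// gt_eqF.
  rewrite exprMn ler_wpM2r ?exprn_ge0 ?ler0n//.
  apply: le_trans hq0; apply: ler_wiXn2l => //; rewrite ?(ltW rho_lt1)//.
  by rewrite leq_divRL ?(mulnC q0)// bE addnS.
rewrite !expnD sum_nat_mulD.
under eq_bigr do under eq_bigr do rewrite sum_nat_mulD.
under eq_bigr do rewrite exchange_big /= .
rewrite (le_trans (ler_norm_sum _ _ _))//.
apply: (@le_trans _ _ (\sum_(0 <= x < 2 ^ m) \sum_(0 <= a < 2 ^ m)
    \sum_(0 <= theta < 2 ^ l) e * (4 ^ nu)%:R)); last first.
  rewrite !big_const_nat !subn0 !iter_addr !addr0 -!mulrnA -[leLHS]mulr_natr.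
  rewrite -!mulrA ler_wpM2l ?(ltW e0)//.
  have -> : (4 ^ nu = 2 ^ nu * 2 ^ nu)%N by rewrite -expnMn.
  by rewrite -!natrM ler_nat; lia.
rewrite [leLHS]big_nat [leRHS]big_nat; apply: ler_sum => x /= xm.
rewrite (le_trans (ler_norm_sum _ _ _))//.
rewrite [leLHS]big_nat [leRHS]big_nat; apply: ler_sum => a /= am.
rewrite sum_nat_mulD exchange_big /=.
rewrite (le_trans (ler_norm_sum _ _ _))//.
apply: ler_sum => theta _.
have iM : {in ds, forall d, (x + d * a) %/ 2 ^ m <= M}%N.
  by move=> d /dsM dM; have := @carry_bound M m x a d (fun=> 0%N) xm am dM isT; rewrite addn0.
rewrite (le_trans _ (Snu theta _ iM))// le_eqVlt; apply/orP; left; apply/eqP.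
congr (`| _ |); rewrite /carry_sum; apply: eq_bigr => y _.
apply: eq_bigr => z _; apply: eq_bigr => d _; congr (tm_sign _ _).
have -> : (x + 2 ^ m * (y + 2 ^ nu * theta) + d * (a + 2 ^ m * z) =
   (y + d * z + 2 ^ nu * theta) * 2 ^ m + (x + d * a))%N by nia.
by rewrite divnMDl ?expn_gt0//; lia.
Qed.

(** The two products merge into one over [r + j] and [r' + j]. For [r < r'] the largest shift,
    [r' + mx], occurs once because [js] has no repetition, and the number of shifts is
    [2 * size js]. *)
Lemma shift_prod_correlation_small (js : seq nat) (r r' : nat) (e : R) :
  uniq js -> js != [::] -> r != r' -> 0 < e ->
  exists nu0, forall nu m l, (nu0 <= nu)%N ->
   `|\sum_(0 <= X < 2 ^ (m + (nu + l))) \sum_(0 <= A < 2 ^ (m + nu))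
      shift_prod m js r X A * shift_prod m js r' X A|
   <= e * (2 ^ (m + (nu + l)))%:R * (2 ^ (m + nu))%:R.
Proof.
move=> ujs js0 + e0; wlog rr' : r r' / (r < r')%N => [hw|].
  rewrite neq_ltn => /orP[lt|lt]; first by apply: hw => //; rewrite neq_ltn lt.
  have [|nu0 h] := hw _ _ lt; first by rewrite neq_ltn lt.
  exists nu0 => nu m l /h => {}h; apply: le_trans (h m l).
  by under eq_bigr do under eq_bigr do rewrite mulrC.
move=> _; set ds := [seq (r + j)%N | j <- js] ++ [seq (r' + j)%N | j <- js].
have [mx mxjs mxP] : exists2 mx, mx \in js & {in js, forall j, j <= mx}%N.
  elim: js js0 {ujs ds} => // j js IH _; have [->|/IH[mx mxjs mxP]] := eqVneq js [::].
    by exists j => [|k]; rewrite mem_seq1// => /eqP ->.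
  exists (maxn j mx); first by rewrite inE /maxn; case: ifP; rewrite ?eqxx// mxjs orbT.
  by move=> k; rewrite inE => /predU1P[->|/mxP kmx]; rewrite leq_max ?leqnn// kmx orbT.
have [||||nu0 h] := @correlation_small ds (r' + mx) e.
- move=> d; rewrite mem_cat => /orP[] /mapP[j /mxP jmx ->]; lia.
- rewrite count_cat !count_map.
  rewrite (eq_in_count (a2 := pred0)) ?count_pred0 => [|j /mxP jmx /=]; last by apply/eqP; lia.
  rewrite (eq_count (a2 := pred1 mx)) => [|j /=]; last by rewrite eqn_add2l.
  by rewrite count_uniq_mem// mxjs.
- by rewrite size_cat !size_map addnn odd_double.
- by [].
exists nu0 => nu m l /h => {}h; apply: le_trans (h m l).
rewrite le_eqVlt; apply/orP; left; apply/eqP; congr (`| _ |).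
apply: eq_bigr => X _; apply: eq_bigr => A _.
by rewrite /ds big_cat !big_map.
Qed.

Lemma shift_prod_sqr m js r X A : shift_prod m js r X A * shift_prod m js r X A = 1.
Proof. by rewrite -big_split big1// => j _ /=; rewrite tm_sign_sqr. Qed.

(* The square of the inner sum expands into [Q] diagonal terms and correlations. *)
Lemma shift_average_small (js : seq nat) (delta : R) :
  uniq js -> js != [::] -> 0 < delta ->
  exists2 Q, (0 < Q)%N &
  exists nu0, forall nu m l, (nu0 <= nu)%N ->
   \sum_(0 <= X < 2 ^ (m + (nu + l))) \sum_(0 <= A < 2 ^ (m + nu))
      `|\sum_(0 <= r < Q) shift_prod m js r X A|
   <= delta * Q%:R * (2 ^ (m + (nu + l)))%:R * (2 ^ (m + nu))%:R.
Proof.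
move=> ujs js0 d0.
(* The diagonal will contribute [(2 / delta ^ 2) * delta / 4] on average, hence at most
   [delta * Q / 4]. *)
set Q := (Num.truncn (2 / delta ^+ 2)).+1.
have Q2 : 2 / delta ^+ 2 <= Q%:R by apply/ltW/truncnS_gt.
exists Q => //.
have e0 : 0 < delta ^+ 2 / 2 by rewrite divr_gt0 ?exprn_gt0.
pose P (p : nat * nat) nu0 := forall nu m l, p.1 != p.2 -> (nu0 <= nu)%N ->
   `|\sum_(0 <= X < 2 ^ (m + (nu + l))) \sum_(0 <= A < 2 ^ (m + nu))
      shift_prod m js p.1 X A * shift_prod m js p.2 X A|
   <= delta ^+ 2 / 2 * (2 ^ (m + (nu + l)))%:R * (2 ^ (m + nu))%:R.
have /boolp.choice[h hP] : forall p, exists nu0, P p nu0.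
  move=> [r r']; have [->|rr'] := eqVneq r r'; first by exists 0%N => nu m l; rewrite eqxx.
  have [nu0 hnu] := shift_prod_correlation_small ujs js0 rr' e0.
  by exists nu0 => nu m l _; exact: hnu.
exists (\max_(p : 'I_Q * 'I_Q) h (p.1 : nat, p.2 : nat)) => nu m l hnu.
set V1 : R := (2 ^ _)%:R; set V2 : R := (2 ^ (m + nu))%:R.
pose S X A := \sum_(0 <= r < Q) shift_prod m js r X A.
have Q0 : 0 < Q%:R :> R by rewrite ltr0n.
(* This takes the place of Cauchy-Schwarz: [y <= t / 2 + y ^ 2 / (2 * t)] with [t = delta * Q]. *)
have amgm X A : `|S X A| <= delta * Q%:R / 2 + S X A ^+ 2 / (2 * delta * Q%:R).
  have dQ : 0 < delta * Q%:R by rewrite mulr_gt0.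
  rewrite -subr_ge0; set y := `|S X A|; have -> : S X A ^+ 2 = y ^+ 2 by rewrite real_normK// num_real.
  have -> : delta * Q%:R / 2 + y ^+ 2 / (2 * delta * Q%:R) - y =
     (delta * Q%:R - y) ^+ 2 / (2 * (delta * Q%:R)).
    by field; rewrite ?gt_eqF.
  by rewrite divr_ge0 ?sqr_ge0// mulr_ge0// ltW.
have V1E : \sum_(0 <= X < 2 ^ (m + (nu + l))) (1 : R) = V1.
  by rewrite big_const_nat iter_addr subn0 addr0.
have V2E : \sum_(0 <= A < 2 ^ (m + nu)) (1 : R) = V2.
  by rewrite big_const_nat iter_addr subn0 addr0.
have sq : \sum_(0 <= X < 2 ^ (m + (nu + l))) \sum_(0 <= A < 2 ^ (m + nu)) S X A ^+ 2
    <= (Q%:R + Q%:R ^+ 2 * (delta ^+ 2 / 2)) * V1 * V2.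
  have -> : \sum_(0 <= X < 2 ^ (m + (nu + l))) \sum_(0 <= A < 2 ^ (m + nu)) S X A ^+ 2 =
      \sum_(r < Q) \sum_(r' < Q) \sum_(0 <= X < 2 ^ (m + (nu + l)))
        \sum_(0 <= A < 2 ^ (m + nu)) shift_prod m js r X A * shift_prod m js r' X A.
    under [RHS]eq_bigr do rewrite exchange_big /=.
    rewrite [RHS]exchange_big /=; apply: eq_bigr => X _.
    under [RHS]eq_bigr do rewrite exchange_big /=.
    rewrite [RHS]exchange_big /=; apply: eq_bigr => A _.
    rewrite /S big_mkord expr2 mulr_suml; apply: eq_bigr => r _.
    by rewrite mulr_sumr.
  apply: (@le_trans _ _ (\sum_(r < Q) \sum_(r' < Q)
     ((r == r')%:R + delta ^+ 2 / 2) * V1 * V2)).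
    apply: ler_sum => r _; apply: ler_sum => r' _.
    have [->|rr'] := eqVneq r r'.
      under eq_bigr do under eq_bigr do rewrite shift_prod_sqr.
      under eq_bigr do rewrite V2E -[V2]mul1r.
      rewrite -mulr_suml V1E -!mulrA ler_peMl ?mulr_ge0 ?ler0n//.
      by have := mulr_gt0 d0 d0; rewrite mulr1n; lra.
    rewrite add0r (le_trans (ler_norm _))// (hP (r : nat, r' : nat))//.
    by rewrite (leq_trans _ hnu)// (leq_bigmax (r, r')).
  under eq_bigr do rewrite -!mulr_suml; rewrite -!mulr_suml.
  rewrite -!mulrA ler_wpM2r ?mulr_ge0 ?ler0n//.
  under eq_bigr do rewrite big_split /= sumr_const card_ord.
  rewrite big_split /= sumr_const card_ord.
  have -> : \sum_(i < Q) \sum_(i0 < Q) (i == i0)%:R = Q%:R :> R.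
    rewrite (eq_bigr (fun=> 1)) ?sumr_const ?card_ord// => r _.
    rewrite (bigD1 r)//= eqxx big1 ?addr0// => r'.
    by rewrite eq_sym => /negPf ->.
  by rewrite -mulrnA -[_ *+ (Q * Q)]mulr_natl natrM -!mulrA.
apply: (@le_trans _ _ (\sum_(0 <= X < 2 ^ (m + (nu + l))) \sum_(0 <= A < 2 ^ (m + nu))
   (delta * Q%:R / 2 * 1 + S X A ^+ 2 / (2 * delta * Q%:R)))).
  by apply: ler_sum => X _; apply: ler_sum => A _; rewrite mulr1 amgm.
under eq_bigr do rewrite big_split /= -mulr_sumr V2E -mulr_suml.
rewrite big_split /= -[X in _ + X]mulr_suml.
have -> : \sum_(0 <= X < 2 ^ (m + (nu + l))) delta * Q%:R / 2 * V2 = delta * Q%:R / 2 * V2 * V1.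
  by rewrite -V1E mulr_sumr; apply: eq_bigr => _ _; rewrite mulr1.
apply: (@le_trans _ _ (delta * Q%:R / 2 * V2 * V1 +
   (Q%:R + Q%:R ^+ 2 * (delta ^+ 2 / 2)) * V1 * V2 / (2 * delta * Q%:R))).
  by rewrite lerD2l ler_wpM2r// invr_ge0 ?mulr_ge0 ?ler0n// ltW.
have -> : delta * Q%:R / 2 * V2 * V1 +
   (Q%:R + Q%:R ^+ 2 * (delta ^+ 2 / 2)) * V1 * V2 / (2 * delta * Q%:R) =
   (delta * Q%:R / 2 + (2 / delta ^+ 2) * delta / 4 + delta / 4 * Q%:R) * (V1 * V2).
  by field; rewrite ?gt_eqF.
rewrite -[leRHS]mulrA ler_wpM2r ?mulr_ge0 ?ler0n//.
have : 2 / delta ^+ 2 * delta / 4 <= Q%:R * delta / 4.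
  by rewrite ler_wpM2r// ler_wpM2r// ltW.
lra.
Qed.

End Correlation.

(** * Sequences that are linear on short windows *)

Lemma count_top M e : (count (fun i => M <= i + e) (iota 0 M) <= e)%N.
Proof.
rewrite -size_filter -[leqRHS](size_iota (M - e)).
apply: uniq_leq_size; first by rewrite filter_uniq ?iota_uniq.
by move=> i; rewrite mem_filter !mem_iota; lia.
Qed.

Lemma sum_modn_shift (V : nmodType) (h : nat -> V) M c :
  \sum_(0 <= i < M) h ((i + c) %% M)%N = \sum_(0 <= i < M) h i.
Proof.
elim: c => [|c IH].
  by rewrite !big_nat; apply: eq_bigr => i iM; rewrite addn0 modn_small.
rewrite -IH; case: M {IH} => [|M]; first by rewrite !big_geq.
rewrite big_nat_recr//= [RHS]big_nat_recl//= addrC; congr (_ + _).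
  by rewrite add0n addnS -addSn modnDl.
by apply: eq_bigr => i _; rewrite addnS addSn.
Qed.

Lemma count_nat_sum (p : pred nat) n0 N :
  count p (index_iota n0 N) = (\sum_(n0 <= n < N) p n)%N.
Proof. by rewrite -sum1_count big_mkcond. Qed.

(** All solutions lie within [L] of the smallest one. *)
Lemma count_near (R : realType) (p : pred nat) (L : R) n0 N : 0 <= L ->
  (forall n n', p n -> p n' -> (n0 <= n < N)%N -> (n0 <= n' < N)%N ->
     (n <= n')%N -> (n' - n)%:R <= L) ->
  (\sum_(n0 <= n < N) p n)%N%:R <= 1 + L.
Proof.
move=> L0 hp; rewrite -count_nat_sum.
have [/hasP[n1' hn1' pn1']|] := boolP (has p (index_iota n0 N)); last first.
  by rewrite has_count -leqNgt leqn0 => /eqP ->; rewrite addr_ge0.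
have ex : exists n, (n0 <= n < N)%N && p n.
  by exists n1'; rewrite -mem_index_iota hn1'.
case: (ex_minnP ex) => n1 /andP[n1N pn1] n1min.
apply: (@le_trans _ _ (Num.truncn L).+1%:R); last first.
  by rewrite -natr1 addrC lerD2l truncn_le.
rewrite ler_nat -size_filter -[leqRHS](size_iota n1).
apply: uniq_leq_size; first by rewrite filter_uniq ?iota_uniq.
move=> n; rewrite mem_filter mem_index_iota => /andP[pn nN].
have n1n : (n1 <= n)%N by apply: n1min; rewrite nN.
have := hp _ _ pn1 pn n1N nN n1n.
rewrite -truncn_ge_nat// mem_iota; lia.
Qed.

Section Linearization.
(* [F n] stands for [2 ^ m * n ^ c] and [a n] for its derivative. *)
Variables (R : realType) (m nu l D n0 N : nat) (F a : nat -> R) (kap amax : R).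

Local Notation P := (2 ^ (m + (nu + l)))%N.

Definition floor_val n := Num.truncn (F n).
Definition floor_slope n := Num.truncn (a n).

Hypothesis F_ge0 : forall n, 0 <= F n.
(** The error is one-sided because [n ^ c] is convex. The range covers a window of [P] steps
    followed by shifts up to [D]. *)
Hypothesis F_lin : forall n u v, (n0 <= n < N)%N -> (n <= u)%N -> (u <= v)%N ->
  (v <= n + P + D)%N -> 0 <= F v - F u - (v - u)%:R * a n < 1.
Hypothesis a_ge2 : forall n, (n0 <= n < N)%N -> 2 <= a n.
Hypothesis a_le : forall n, (n0 <= n < N)%N -> a n <= amax.
Hypothesis amax_ge0 : 0 <= amax.
Hypothesis amax_lt : amax < (2 ^ (m + nu))%:R.
Hypothesis kap_gt0 : 0 < kap.
Hypothesis kap_le : kap * P%:R <= 1.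
Hypothesis a_incr : forall n n', (n0 <= n < N)%N -> (n0 <= n' < N)%N ->
  (n <= n')%N -> kap * (n' - n)%:R <= a n' - a n.

(** The error [e] collects at most [d] from rounding the slope, less than 1 from rounding
    [F (n + k)] and less than 1 from the linearization. *)
Lemma floor_val_lin n k d : (n0 <= n < N)%N -> (k < P)%N -> (d <= D)%N ->
  exists2 e, (e <= d.+1)%N & floor_val (n + k + d) = (floor_val (n + k) + d * floor_slope n + e)%N.
Proof.
move=> nN kP dD.
have := @F_lin n (n + k) (n + k + d) nN (leq_addr _ _) (leq_addr _ _).
rewrite -addnA -addnA !leq_add2l => /(_ (leq_add (ltnW kP) dD)).
rewrite !addnA addKn => /andP[h1 h2].
have /truncn_itv/andP[] := F_ge0 (n + k + d); rewrite -/(floor_val _) => f1 f2.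
have /truncn_itv/andP[] := F_ge0 (n + k); rewrite -/(floor_val _) => f3 f4.
have /truncn_itv/andP[] : 0 <= a n by apply: le_trans (a_ge2 nN).
rewrite -/(floor_slope _) => f5 f6.
have d5 : d%:R * (floor_slope n)%:R <= d%:R * a n by rewrite ler_wpM2l.
have d6 : d%:R * a n <= d%:R * (floor_slope n).+1%:R by rewrite ler_wpM2l// ltW.
have lo : (floor_val (n + k) + d * floor_slope n <= floor_val (n + k + d))%N.
  by rewrite -ltnS -(ltr_nat R) natrD natrM; lra.
exists (floor_val (n + k + d) - (floor_val (n + k) + d * floor_slope n))%N; last by rewrite subnKC.
rewrite leq_subLR -ltnS -(ltr_nat R) -!addnS !natrD natrM.
rewrite -!natr1 in f2 f4 d6 *; lra.
Qed.

(* The residues [X] whose block either wraps around modulo [P] or comes within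
   the rounding error of a carry into the digits of index at least [m]. *)
Definition exceptional X A : bool :=
  (P <= X + D * A)%N || [exists d : 'I_D.+1, 2 ^ m <= (X + d * A) %% 2 ^ m + d.+1]%N.

(** Only the last [D * A] residues wrap around. For each [d] and each value of the upper [nu + l]
    digits, adding [d * A] rotates the [m] low digits, so at most [d + 1] of them come too close to
    a carry. *)
Lemma count_exceptional A : (A < 2 ^ (m + nu))%N ->
  (\sum_(0 <= X < P) exceptional X A <= D * 2 ^ (m + nu) + D.+1 ^ 2 * 2 ^ (nu + l))%N.
Proof.
move=> AA.
apply: (@leq_trans (\sum_(0 <= X < P) ((P <= X + D * A) +
   \sum_(d < D.+1) (2 ^ m <= (X + d * A) %% 2 ^ m + d.+1)))%N).
  apply: leq_sum => X _; rewrite /exceptional.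
  have [_|_] := leqP P (X + D * A)%N; rewrite /= ?leq_addr//.
  case: existsP => // -[d hd].
  by rewrite (bigD1 d)//= hd; lia.
rewrite big_split /= leq_add//.
  rewrite -count_nat_sum /index_iota subn0 (leq_trans (count_top _ _))//.
  by rewrite leq_mul2l (ltnW AA) orbT.
rewrite exchange_big /= expnS expn1.
apply: (@leq_trans (\sum_(d < D.+1) D.+1 * 2 ^ (nu + l))%N); last first.
  by rewrite sum_nat_const card_ord mulnA.
apply: leq_sum => d _; rewrite expnD sum_nat_mulD exchange_big /=.
apply: (@leq_trans (\sum_(0 <= j < 2 ^ (nu + l)) D.+1)%N); last first.
  by rewrite sum_nat_const_nat subn0 mulnC.
apply: leq_sum => j _.
rewrite (eq_bigr (fun i => (2 ^ m <= (i + d * A) %% 2 ^ m + d.+1) : nat)); last first.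
  by move=> i _; rewrite addnAC [(i + _ + _)%N]addnC mulnC modnMDl.
rewrite (sum_modn_shift (fun i => (2 ^ m <= i + d.+1)%N : nat)).
by rewrite -count_nat_sum /index_iota subn0 (leq_trans (count_top _ _)).
Qed.

(* If [floor_val (n + k)] and [floor_val (n + k + h)] are congruent modulo [P],
   then [h] is a near return; so near returns control how often a residue class
   is hit. *)
Definition near_return n h : bool :=
  `[< exists u : nat, `|h%:R * a n - (u * P)%:R| < 2 >].

Definition returns n := (\sum_(1 <= h < P) near_return n h)%N.

(** The 1 counts the first visit [k1]; the distances from it to the later visits are distinct near
    returns. *)
Lemma count_residue n X : (n0 <= n < N)%N ->
  (\sum_(0 <= k < P) (floor_val (n + k) %% P == X) <= 1 + returns n)%N.
Proof.
move=> nN.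
have [/hasP[k' k'P hk']|] := boolP (has (fun k => floor_val (n + k) %% P == X)%N (index_iota 0 P));
    last first.
  by rewrite has_count -leqNgt leqn0 count_nat_sum => /eqP ->.
have ex : exists k, (k < P)%N && (floor_val (n + k) %% P == X)%N.
  by exists k'; move: k'P; rewrite mem_index_iota => /andP[_ ->].
case: (ex_minnP ex) => k1 /andP[k1P /eqP hk1] kmin.
rewrite (big_cat_nat (n := k1))//=; last exact: ltnW.
rewrite big_nat big1 => [|k /andP[_ kk1]]; last first.
  apply/eqP; rewrite eqb0; apply: contraTN kk1 => hk; rewrite -leqNgt.
  have [Pk|kP] := leqP P k; first by rewrite (leq_trans (ltnW k1P)).
  by apply: kmin; rewrite kP.
rewrite add0n big_ltn// leq_add//; first by case: eqP.
rewrite -{1}[k1.+1]addn1 addnC big_addn.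
apply: (@leq_trans (\sum_(1 <= h < P - k1) near_return n h)%N); last first.
  rewrite /returns [leqRHS](big_cat_nat (n := (P - k1)%N)) ?leq_addr//= ?leq_subr//.
  by rewrite subn_gt0.
rewrite [leqLHS]big_nat [leqRHS]big_nat; apply: leq_sum => h /andP[h1 hP].
case: eqP => // hh; rewrite (_ : near_return n h)//; apply/asboolP.
have := @F_lin n (n + k1) (n + (h + k1)) nN (leq_addr _ _).
have -> : (n + k1 <= n + (h + k1))%N by rewrite leq_add2l leq_addl.
have -> : (n + (h + k1) <= n + P + D)%N.
  rewrite -addnA leq_add2l (leq_trans _ (leq_addr _ _))// addnC ltnW//.
  by rewrite -ltn_subRL.
have -> : (n + (h + k1) - (n + k1) = h)%N by rewrite subnDl addnK.
move=> /(_ isT isT)/andP[g1 g2].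
have /truncn_itv/andP[] := F_ge0 (n + (h + k1)); rewrite -/(floor_val _) => f1 f2.
have /truncn_itv/andP[] := F_ge0 (n + k1); rewrite -/(floor_val _) => f3 f4.
have ha : 0 <= h%:R * a n by rewrite mulr_ge0// (le_trans _ (a_ge2 nN)).
have ZZ : (floor_val (n + k1) <= floor_val (n + (h + k1)))%N.
  by rewrite -ltnS -(ltr_nat R); lra.
(* The division is exact. The bound 2 is the linearization error, below 1, plus the difference of
   two fractional parts, also below 1. *)
exists ((floor_val (n + (h + k1)) - floor_val (n + k1)) %/ P)%N.
rewrite divnK; last first.
  by rewrite -eqn_mod_dvd//; apply/eqP; rewrite hk1 hh.
rewrite natrB// ltr_norml -!natr1 in f2 f4 *; apply/andP; split; lra.
Qed.

(** For fixed [u], the condition confines [h * a n] to an interval of length 4; as it grows by at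
    least [h * kap] per step, at most [5 / (h * kap)] values of [n] qualify. There are at most
    [2 * h * amax / P] values of [u]. *)
Lemma sum_near_return h : (1 <= h < P)%N ->
  (\sum_(n0 <= n < N) near_return n h)%N%:R <= 10 * amax / (P%:R * kap).
Proof.
move=> /andP[h1 hP].
have h_gt0 : 0 < h%:R :> R by rewrite ltr0n.
have h_ge1 : 1 <= h%:R :> R by rewrite ler1n.
have P_gt0 : 0 < P%:R :> R by rewrite ltr0n expn_gt0.
have hk0 : 0 < h%:R * kap by rewrite mulr_gt0.
have hk1 : h%:R * kap <= 1.
  apply: le_trans kap_le; rewrite mulrC ler_wpM2l ?(ltW kap_gt0)//.
  by rewrite ler_nat ltnW.
set U := Num.truncn (2 * h%:R * amax / P%:R).
have U_ge0 : 0 <= 2 * h%:R * amax / P%:R by rewrite divr_ge0 ?mulr_ge0 ?ler0n.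
pose close u n := `|h%:R * a n - (u * P)%:R| < 2.
have count_close u : (\sum_(n0 <= n < N) close u n)%N%:R <= 5 / (h%:R * kap).
  have : 1 <= (h%:R * kap)^-1 by rewrite invf_ge1.
  have : (\sum_(n0 <= n < N) close u n)%N%:R <= 1 + 4 / (h%:R * kap).
    apply: count_near => [|n n' cn cn' nN nN' nn']; first by rewrite divr_ge0 ?ltW.
    rewrite ler_pdivlMr// mulrCA.
    have : h%:R * (kap * (n' - n)%:R) <= h%:R * (a n' - a n).
      by rewrite ler_wpM2l ?a_incr.
    rewrite mulrA -mulrA [X in _ * X]mulrC.
    move: cn cn'; rewrite /close !ltr_norml; lra.
  lra.
apply: (@le_trans _ _ (\sum_(1 <= u < U.+1) (\sum_(n0 <= n < N) close u n)%N%:R)).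
  rewrite -natr_sum ler_nat exchange_big /=.
  rewrite [leqLHS]big_nat [leqRHS]big_nat; apply: leq_sum => n nN.
  rewrite /near_return; case: asboolP => // -[u hu].
  (* This excludes [u = 0], which would spoil the bound for small [h], and gives
     [u * P <= 2 * h * amax]. *)
  have ha2 : 2 <= h%:R * a n.
    by rewrite (le_trans (a_ge2 nN))// ler_peMl// (le_trans _ (a_ge2 nN)).
  have u1 : (1 <= u)%N.
    rewrite lt0n; apply/negP => /eqP u0; move: hu.
    by rewrite u0 mul0n subr0 ltr_norml => /andP[_]; lra.
  have uU : (u < U.+1)%N.
    rewrite ltnS truncn_ge_nat//.
    rewrite ler_pdivlMr// -natrM.
    have : h%:R * a n <= h%:R * amax by rewrite ler_wpM2l ?a_le.
    by move: hu; rewrite ltr_norml; lra.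
  by rewrite (big_cat_nat u1 (ltnW uU))/= [X in (_ + X)%N]big_ltn// /close hu addnCA leq_addr.
apply: (@le_trans _ _ (\sum_(1 <= u < U.+1) 5 / (h%:R * kap))).
  by apply: ler_sum => u _.
rewrite big_const_nat iter_addr addr0 subSS subn0 -[leLHS]mulr_natr.
apply: (@le_trans _ _ (5 / (h%:R * kap) * (2 * h%:R * amax / P%:R))).
  by rewrite ler_wpM2l ?divr_ge0 ?(ltW hk0)// truncn_le.
rewrite le_eqVlt; apply/orP; left; apply/eqP; field.
by rewrite !gt_eqF.
Qed.

Lemma sum_returns :
  (\sum_(n0 <= n < N) returns n)%N%:R <= 10 * amax / kap.
Proof.
have P_gt0 : 0 < P%:R :> R by rewrite ltr0n expn_gt0.
rewrite exchange_big natr_sum /=.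
apply: (@le_trans _ _ (\sum_(1 <= h < P) 10 * amax / (P%:R * kap))).
  by rewrite [leLHS]big_nat [leRHS]big_nat; apply: ler_sum => h; exact: sum_near_return.
rewrite big_const_nat iter_addr addr0 -[leLHS]mulr_natr.
apply: (@le_trans _ _ (10 * amax / (P%:R * kap) * P%:R)).
  rewrite ler_wpM2l ?ler_nat ?leq_subr//.
  by rewrite divr_ge0 ?mulr_ge0 ?ler0n// ltW.
rewrite le_eqVlt; apply/orP; left; apply/eqP; field.
by rewrite !gt_eqF.
Qed.

(** The slope grows by at least [kap] per step, so each integer part is taken at most
    [1 + 1 / kap <= 2 / kap] times. *)
Lemma sum_slope_le (W : nat -> R) : (forall x, 0 <= W x) ->
  \sum_(n0 <= n < N) W (floor_slope n) <= 2 / kap * \sum_(0 <= x < 2 ^ (m + nu)) W x.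
Proof.
move=> W0; rewrite mulr_sumr.
have aA n : (n0 <= n < N)%N -> (floor_slope n)%:R <= a n < (floor_slope n).+1%:R.
  by move=> nN; apply: truncn_itv; rewrite (le_trans _ (a_ge2 nN)).
apply: (@le_trans _ _ (\sum_(0 <= x < 2 ^ (m + nu))
    (\sum_(n0 <= n < N) (floor_slope n == x))%N%:R * W x)).
  under [leRHS]eq_bigr do rewrite natr_sum mulr_suml.
  rewrite exchange_big /= [leLHS]big_nat [leRHS]big_nat; apply: ler_sum => n nN.
  have An : (floor_slope n < 2 ^ (m + nu))%N.
    rewrite -(ltr_nat R) (le_lt_trans _ amax_lt)// (le_trans _ (a_le nN))//.
    by have /andP[] := aA _ nN.
  rewrite (big_cat_nat (leq0n _) (ltnW An))/= [X in _ <= _ + X]big_ltn//.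
  rewrite eqxx mul1r addrCA lerDl addr_ge0// sumr_ge0// => i _; exact: mulr_ge0.
apply: ler_sum => x _; rewrite ler_wpM2r//.
have k1 : 1 <= kap^-1.
  rewrite invf_ge1//; apply: le_trans kap_le.
  by rewrite ler_peMr ?(ltW kap_gt0)// ler1n expn_gt0.
suff : (\sum_(n0 <= n < N) (floor_slope n == x))%N%:R <= 1 + kap^-1 by lra.
apply: count_near => [|n n' /eqP An /eqP An' nN nN' nn']; first by lra.
rewrite -[leRHS]mul1r ler_pdivlMr// mulrC.
apply: le_trans (a_incr nN nN' nn') _.
have := aA _ nN; have := aA _ nN'; rewrite An An' -!natr1; lra.
Qed.

(** * Averaging block signs over windows and shifts *)

Section Blocks.
Variables (js : seq nat) (Q : nat).
Hypothesis js_le : forall r j, (r < Q)%N -> j \in js -> (r + j <= D)%N.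

Definition block_sign n : R := \prod_(j <- js) tm_sign R (floor_val (n + j) %/ 2 ^ m).

Lemma norm_block_sign n : `|block_sign n| = 1.
Proof. exact: norm_prod_tm_sign. Qed.

(** Off the exceptional set the rounding error never carries into digit [m], and [X + d * A < P]
    leaves the quotient by [P] unchanged. Each [j] thus contributes the same upper sign, whatever
    [r] is. *)
Lemma block_sign_shift n k r : (n0 <= n < N)%N -> (k < P)%N -> (r < Q)%N ->
  let X := (floor_val (n + k) %% P)%N in ~~ exceptional X (floor_slope n) ->
  block_sign (n + k + r) =
  tm_sign R (floor_val (n + k) %/ P) ^+ size js * shift_prod R m js r X (floor_slope n).
Proof.
move=> nN kP rQ X; rewrite negb_or -ltnNge => /andP[XP /existsPn noX].
rewrite /block_sign /shift_prod.
have -> : tm_sign R (floor_val (n + k) %/ P) ^+ size js =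
    \prod_(j <- js) tm_sign R (floor_val (n + k) %/ P).
  by rewrite big_const_seq count_predT iter_mulr_1.
rewrite -big_split; apply: eq_big_seq => j jjs /=.
have dD := js_le rQ jjs; set d := (r + j)%N.
rewrite -addnA -/d; have [e ed ->] := floor_val_lin nN kP dD.
have := noX (Ordinal (dD : (d < D.+1)%N)); rewrite -ltnNge /= => he.
have XdP : (X + d * floor_slope n < P)%N by rewrite (leq_ltn_trans _ XP)// leq_add2l leq_mul2r dD orbT.
rewrite {1}(divn_eq (floor_val (n + k)) P) -/X.
have -> : ((floor_val (n + k) %/ P * P + X + d * floor_slope n + e) %/ 2 ^ m =
    2 ^ (nu + l) * (floor_val (n + k) %/ P) + (X + d * floor_slope n) %/ 2 ^ m)%N.
  move: (floor_val (n + k) %/ P)%N => q; have -> : (q * P + X + d * floor_slope n + e =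
      (2 ^ (nu + l) * q) * 2 ^ m + (X + d * floor_slope n + e))%N.
    by rewrite (expnD 2 m); lia.
  rewrite divnMDl ?expn_gt0//; congr (_ + _)%N.
  rewrite {1}(divn_eq (X + d * floor_slope n) (2 ^ m)) -addnA divnMDl ?expn_gt0//.
  by rewrite [X in (_ + X)%N]divn_small ?addn0// (leq_ltn_trans _ he)// leq_add2l.
by rewrite tm_sign_split// ltn_divLR ?expn_gt0// -expnD [(_ + m)%N]addnC.
Qed.

Lemma block_sum_le n k : (n0 <= n < N)%N -> (k < P)%N ->
  `|\sum_(0 <= r < Q) block_sign (n + k + r)| <=
  `|\sum_(0 <= r < Q) shift_prod R m js r (floor_val (n + k) %% P) (floor_slope n)| +
  Q%:R * (exceptional (floor_val (n + k) %% P) (floor_slope n))%:R.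
Proof.
move=> nN kP; set X := (floor_val (n + k) %% P)%N; have [eX|neX] := boolP (exceptional X (floor_slope n)).
  rewrite mulr1 (le_trans (ler_norm_sum _ _ _))//.
  under eq_bigr do rewrite norm_block_sign.
  by rewrite big_const_nat iter_addr addr0 subn0 lerDr.
rewrite mulr0 addr0 le_eqVlt; apply/orP; left; apply/eqP.
rewrite !big_mkord (eq_bigr (fun r : 'I_Q => tm_sign R (floor_val (n + k) %/ P) ^+ size js *
  shift_prod R m js r X (floor_slope n))) => [|r _]; last exact: block_sign_shift.
by rewrite -mulr_sumr normrM normrX norm_tm_sign expr1n mul1r.
Qed.

Lemma block_sign_translate s :
  `|\sum_(n0 <= n < N) block_sign n - \sum_(n0 <= n < N) block_sign (n + s)| <= 2 * s%:R.
Proof.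
have [Nn0|n0N] := leqP N n0; first by rewrite !big_geq// subrr normr0 mulr_ge0.
elim: s => [|s IH].
  by under [X in _ - X]eq_bigr do rewrite addn0; rewrite subrr normr0 mulr0.
set S := \sum_(n0 <= n < N) block_sign n in IH *.
have -> : \sum_(n0 <= n < N) block_sign (n + s.+1) =
    \sum_(n0 <= n < N) block_sign (n + s) - block_sign (n0 + s) + block_sign (N + s).
  under eq_bigr do rewrite addnS -addSn.
  rewrite -(big_add1 _ _ n0 N.+1 xpredT (fun n => block_sign (n + s))).
  rewrite (big_ltn n0N) big_nat_recr//=; ring.
move: IH; have := norm_block_sign (n0 + s); have := norm_block_sign (N + s).
set T := \sum_(n0 <= n < N) _; set x := block_sign (N + s); set y := block_sign (n0 + s).
move=> hx hy IH; have -> : S - (T - y + x) = (S - T) + y - x by ring.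
rewrite (le_trans (ler_normB _ _))// hx (le_trans (lerD (ler_normD _ _) (lexx _)))// hy.
by rewrite -natr1; lra.
Qed.

(* Markov's inequality disposes of the [n] with more than [Bd] near returns. *)
Lemma sum_blocks_le n (Bd : R) : (n0 <= n < N)%N -> 0 < Bd ->
  \sum_(0 <= k < P) `|\sum_(0 <= r < Q) block_sign (n + k + r)| <=
  P%:R * Q%:R / Bd * (1 + (returns n)%:R) +
  Bd * (\sum_(0 <= X < P) `|\sum_(0 <= r < Q) shift_prod R m js r X (floor_slope n)| +
        Q%:R * (\sum_(0 <= X < P) exceptional X (floor_slope n))%N%:R).
Proof.
move=> nN Bd0.
pose Psi X := `|\sum_(0 <= r < Q) shift_prod R m js r X (floor_slope n)| +
   Q%:R * (exceptional X (floor_slope n))%:R.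
have Psi0 X : 0 <= Psi X by rewrite addr_ge0// mulr_ge0.
have -> : \sum_(0 <= X < P) `|\sum_(0 <= r < Q) shift_prod R m js r X (floor_slope n)| +
    Q%:R * (\sum_(0 <= X < P) exceptional X (floor_slope n))%N%:R = \sum_(0 <= X < P) Psi X.
  by rewrite big_split /= natr_sum mulr_sumr.
have [bad|good] := ltP Bd (1 + (returns n)%:R).
  rewrite -[leLHS]addr0 lerD ?mulr_ge0 ?sumr_ge0 ?(ltW Bd0)//.
  apply: (@le_trans _ _ (P%:R * Q%:R)).
    apply: (@le_trans _ _ (\sum_(0 <= k < P) Q%:R)).
      apply: ler_sum => k _; rewrite (le_trans (ler_norm_sum _ _ _))//.
      under eq_bigr do rewrite norm_block_sign.
      by rewrite big_const_nat iter_addr addr0 subn0.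
    by rewrite big_const_nat iter_addr addr0 subn0 mulr_natl.
  rewrite -mulrA ler_peMr ?mulr_ge0// mulrC ler_pdivlMr// mul1r.
  exact: ltW.
rewrite -[leLHS]add0r lerD ?mulr_ge0 ?addr_ge0 ?invr_ge0 ?(ltW Bd0)//.
apply: (@le_trans _ _ (\sum_(0 <= k < P) Psi (floor_val (n + k) %% P)%N)).
  by rewrite [leLHS]big_nat [leRHS]big_nat; apply: ler_sum => k /= kP; apply: block_sum_le.
have P0 : (0 < P)%N by rewrite expn_gt0.
(* The [k] are grouped by residue: each residue is visited at most [Bd] times, and [Psi] is
   nonnegative. *)
apply: (@le_trans _ _ (\sum_(0 <= X < P)
    (\sum_(0 <= k < P) (floor_val (n + k) %% P == X))%N%:R * Psi X)).
  under [leRHS]eq_bigr do rewrite natr_sum mulr_suml.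
  rewrite exchange_big /=; apply: ler_sum => k _.
  have XP : (floor_val (n + k) %% P < P)%N by rewrite ltn_pmod.
  rewrite [leRHS](big_cat_nat (leq0n _) (ltnW XP))/= [X in _ <= _ + X]big_ltn//.
  by rewrite eqxx mul1r addrCA lerDl addr_ge0// sumr_ge0// => i _; exact: mulr_ge0.
rewrite mulr_sumr; apply: ler_sum => X _; rewrite ler_wpM2r//.
apply: le_trans good; rewrite -(natrD _ 1) ler_nat; exact: count_residue.
Qed.

(** The sum is averaged over its [P * Q] translates by [k + r]. The four terms come from
    translation, from the [n] with too many near returns, from the mean over residues and slopes,
    and from exceptional residues. *)
Lemma sum_block_sign_le (delta Bd : R) : (0 < Q)%N -> 0 < Bd ->
  \sum_(0 <= X < P) \sum_(0 <= x < 2 ^ (m + nu))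
    `|\sum_(0 <= r < Q) shift_prod R m js r X x|
  <= delta * Q%:R * P%:R * (2 ^ (m + nu))%:R ->
  `|\sum_(n0 <= n < N) block_sign n| <=
  2 * (P + Q)%:R + (N%:R + 10 * amax / kap) / Bd +
  Bd * (2 / kap * delta * (2 ^ (m + nu))%:R) +
  Bd * N%:R * (D%:R / (2 ^ l)%:R + D.+1%:R ^+ 2 / (2 ^ m)%:R).
Proof.
move=> Q0 Bd0 hW.
have PR0 : 0 < P%:R :> R by rewrite ltr0n expn_gt0.
have QR0 : 0 < Q%:R :> R by rewrite ltr0n.
set G := \sum_(n0 <= n < N) block_sign n.
pose T := \sum_(n0 <= n < N) \sum_(0 <= k < P)
  `|\sum_(0 <= r < Q) block_sign (n + k + r)|.
have shiftle : P%:R * Q%:R * `|G| <= T + P%:R * Q%:R * (2 * (P + Q)%:R).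
  have -> : P%:R * Q%:R * `|G| = `|\sum_(0 <= k < P) \sum_(0 <= r < Q) G|.
    rewrite !big_const_nat !iter_addr !addr0 !subn0 -mulrnA mulnC.
    by rewrite normrMn -[RHS]mulr_natl natrM.
  have -> : \sum_(0 <= k < P) \sum_(0 <= r < Q) G =
     \sum_(n0 <= n < N) \sum_(0 <= k < P) \sum_(0 <= r < Q) block_sign (n + k + r) +
     \sum_(0 <= k < P) \sum_(0 <= r < Q)
       (G - \sum_(n0 <= n < N) block_sign (n + (k + r))).
    rewrite [X in _ = X + _]exchange_big /= -big_split; apply: eq_bigr => k _ /=.
    rewrite [X in _ = X + _]exchange_big /= -big_split; apply: eq_bigr => r _ /=.
    by under eq_bigr do rewrite -addnA; rewrite addrC subrK.
  rewrite (le_trans (ler_normD _ _))// lerD//.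
    rewrite (le_trans (ler_norm_sum _ _ _))//; apply: ler_sum => n _.
    by rewrite (le_trans (ler_norm_sum _ _ _)).
  have -> : P%:R * Q%:R * (2 * (P + Q)%:R) =
      \sum_(0 <= k < P) \sum_(0 <= r < Q) (2 * (P + Q)%:R) :> R.
    rewrite !big_const_nat !iter_addr !addr0 !subn0 -mulrnA mulnC.
    by rewrite -[RHS]mulr_natl natrM.
  rewrite (le_trans (ler_norm_sum _ _ _))// [leLHS]big_nat [leRHS]big_nat.
  apply: ler_sum => k /= kP.
  rewrite (le_trans (ler_norm_sum _ _ _))// [leLHS]big_nat [leRHS]big_nat.
  apply: ler_sum => r /= rQ.
  rewrite (le_trans (block_sign_translate _))// ler_wpM2l// ler_nat.
  by rewrite leq_add// ltnW.
have Tle : T <= P%:R * Q%:R / Bd * (N%:R + 10 * amax / kap) +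
    Bd * (2 / kap * (delta * Q%:R * P%:R * (2 ^ (m + nu))%:R) +
     Q%:R * (N%:R * (D * 2 ^ (m + nu) + D.+1 ^ 2 * 2 ^ (nu + l))%:R)).
  apply: (@le_trans _ _ (\sum_(n0 <= n < N) (P%:R * Q%:R / Bd * (1 + (returns n)%:R) +
    Bd * (\sum_(0 <= X < P) `|\sum_(0 <= r < Q) shift_prod R m js r X (floor_slope n)| +
        Q%:R * (\sum_(0 <= X < P) exceptional X (floor_slope n))%N%:R)))).
    by rewrite /T [leLHS]big_nat [leRHS]big_nat; apply: ler_sum => n nN; exact: sum_blocks_le.
  rewrite big_split /= -!mulr_sumr; apply: lerD.
    rewrite ler_wpM2l ?divr_ge0 ?mulr_ge0 ?(ltW Bd0)//.
    rewrite big_split /= -natr_sum; apply: lerD; last exact: sum_returns.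
    by rewrite big_const_nat iter_addr addr0 ler_nat leq_subr.
  rewrite ler_wpM2l ?(ltW Bd0)// big_split /= -mulr_sumr; apply: lerD.
    pose W x := \sum_(0 <= X < P) `|\sum_(0 <= r < Q) shift_prod R m js r X x|.
    apply: (le_trans (@sum_slope_le W _)).
      by move=> x; apply: sumr_ge0.
    by rewrite ler_wpM2l ?divr_ge0 ?(ltW kap_gt0)// /W exchange_big.
  rewrite ler_wpM2l// -natr_sum -natrM ler_nat.
  apply: (@leq_trans (\sum_(n0 <= n < N)
      (D * 2 ^ (m + nu) + D.+1 ^ 2 * 2 ^ (nu + l)))%N); last first.
    by rewrite sum_nat_const_nat leq_mul2r leq_subr orbT.
  rewrite [leqLHS]big_nat [leqRHS]big_nat; apply: leq_sum => n nN.
  apply: count_exceptional; rewrite -(ltr_nat R) (le_lt_trans _ amax_lt)//.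
  rewrite (le_trans _ (a_le nN))// truncn_le.
  by rewrite (le_trans _ (a_ge2 nN)).
have PQ : 0 < P%:R * Q%:R :> R by rewrite mulr_gt0.
rewrite -(ler_pM2l PQ) (le_trans shiftle)// (le_trans (lerD Tle (lexx _)))//.
have PE : P%:R = (2 ^ m)%:R * (2 ^ nu)%:R * (2 ^ l)%:R :> R by rewrite !expnD !natrM mulrA.
rewrite natrD !natrM !expnD !natrM natrX le_eqVlt; apply/orP; left; apply/eqP.
rewrite natrD !natrM; field.
by rewrite !gt_eqF// ?ltr0n ?expn_gt0.
Qed.

End Blocks.

End Linearization.

(** * Powers *)

Section Power.
Variable R : realType.
Implicit Types x y u v c s : R.

Lemma powR_diff s x y : 0 < x -> x <= y ->
  exists2 z, x <= z <= y & y `^ s - x `^ s = s * z `^ (s - 1) * (y - x).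
Proof.
move=> x0 xy.
have [||z] := @MVT_segment R (fun t => t `^ s) (fun z => s * z `^ (s - 1)) x y xy.
- by move=> z; rewrite in_itv /= => /andP[xz _]; apply: is_derive1_powR; exact: lt_trans xz.
- apply: derivable_within_continuous => z; rewrite in_itv /= => /andP[xz _].
  by apply: derivable_powR; rewrite in_itv /= andbT (lt_le_trans x0).
- by rewrite in_itv /= => zxy ->; exists z.
Qed.

Lemma powR_nonincr s x y : 0 <= s -> 0 < x -> x <= y -> y `^ (- s) <= x `^ (- s).
Proof.
move=> s0 x0 xy; have y0 := lt_le_trans x0 xy.
rewrite !powRN lef_pV2 ?posrE ?powR_gt0//.
by apply: ge0_ler_powR => //; rewrite nnegrE ltW.
Qed.

(** The mean value theorem is applied to [t ^ c] on [[u, v]], then to [t ^ (c - 1)] from [x] to the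
    intermediate point; [t ^ (c - 2)] is nonincreasing. *)
Lemma powR_tangent c x u v : 1 <= c <= 2 -> 0 < x -> x <= u -> u <= v ->
  0 <= v `^ c - u `^ c - (v - u) * (c * x `^ (c - 1)) <=
  (v - u) * (v - x) * (c * (c - 1) * x `^ (c - 2)).
Proof.
move=> /andP[c1 c2] x0 xu uv; have u0 := lt_le_trans x0 xu.
have [z /andP[uz zv] ->] := powR_diff c u0 uv.
have xz := le_trans xu uz.
have [w /andP[xw wz] E] := powR_diff (c - 1) x0 xz.
have c0 : 0 <= c by lra.
have -> : c * z `^ (c - 1) * (v - u) - (v - u) * (c * x `^ (c - 1)) =
   (v - u) * (c * (z `^ (c - 1) - x `^ (c - 1))) by ring.
have h : 0 <= v - u by rewrite subr_ge0.
have h' : 0 <= z - x by rewrite subr_ge0.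
have h1 : 0 <= c - 1 by rewrite subr_ge0.
rewrite E; apply/andP; split.
  by rewrite !mulr_ge0// powR_ge0.
rewrite -[leRHS]mulrA ler_wpM2l//.
have -> : (v - x) * (c * (c - 1) * x `^ (c - 2)) =
   c * ((c - 1) * x `^ (c - 2) * (v - x)) by ring.
rewrite ler_wpM2l// ler_pM ?mulr_ge0 ?powR_ge0//; last by rewrite lerD2r.
rewrite ler_wpM2l//.
have -> : c - 1 - 1 = - (2 - c) by ring.
have -> : c - 2 = - (2 - c) by ring.
by apply: powR_nonincr => //; rewrite subr_ge0.
Qed.

Lemma powR_slope c x y N : 1 <= c <= 2 -> 0 < x -> x <= y -> y <= N ->
  c * (c - 1) * N `^ (c - 2) * (y - x) <= c * y `^ (c - 1) - c * x `^ (c - 1).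
Proof.
move=> /andP[c1 c2] x0 xy yN; rewrite -mulrBr.
have [z /andP[xz zy] ->] := powR_diff (c - 1) x0 xy.
rewrite -!mulrA ler_wpM2l//; first lra.
rewrite ler_wpM2l ?subr_ge0// ler_wpM2r ?subr_ge0//.
have -> : c - 1 - 1 = - (2 - c) by ring.
have -> : c - 2 = - (2 - c) by ring.
apply: powR_nonincr; rewrite ?subr_ge0//; last exact: le_trans yN.
exact: lt_le_trans xz.
Qed.

Lemma powR_nat_large s C : 0 < s ->
  exists N0, forall N, (N0 <= N)%N -> C <= N%:R `^ s :> R.
Proof.
move=> s0; set K := Num.max C 1; have K1 : 1 <= K by rewrite le_max lexx orbT.
exists (Num.truncn (K `^ s^-1)).+1 => N hN.
have KN : K `^ s^-1 <= N%:R.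
  by apply/ltW/(lt_le_trans (truncnS_gt _)); rewrite ler_nat.
apply: (@le_trans _ _ K); first by rewrite le_max lexx.
have -> : K = (K `^ s^-1) `^ s.
  by rewrite -powRrM mulVf ?gt_eqF// powRr1// (le_trans _ K1).
by apply: ge0_ler_powR; rewrite ?nnegrE ?powR_ge0// ltW.
Qed.

Lemma exists_pow2_ge (C : R) : exists2 l, (0 < l)%N & C <= (2 ^ l)%:R.
Proof.
exists (Num.truncn C).+1 => //; apply: (le_trans (ltW (truncnS_gt _))).
by rewrite ler_nat ltnW// ltn_expl.
Qed.

Lemma exists_pow2_between y : 1 <= y -> exists nu, y < (2 ^ nu)%:R <= 2 * y.
Proof.
move=> y1; have ty : (0 < Num.truncn y)%N by rewrite truncn_gt0.
have /andP[h1 h2] := up_log_bounds (isT : 1 < 2)%N (ty : (1 < (Num.truncn y).+1)%N).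
exists (up_log 2 (Num.truncn y).+1); apply/andP; split.
  by apply: (lt_le_trans (truncnS_gt _)); rewrite ler_nat.
have : (0 < up_log 2 (Num.truncn y).+1)%N by rewrite up_log_gt0.
case: up_log h1 {h2} => // k; rewrite /= ltnS => h _.
rewrite expnS natrM ler_wpM2l// (@le_trans _ _ (Num.truncn y)%:R) ?ler_nat//.
by rewrite truncn_le (le_trans _ y1).
Qed.

(** With [M = 2 ^ m], this recovers the integer part of [n ^ c] from a value that keeps [m] binary
    digits after the point. *)
Lemma truncn_mulr_divn M x : (0 < M)%N -> 0 <= x ->
  (Num.truncn (M%:R * x) %/ M)%N = Num.truncn x.
Proof.
move=> M0 x0; have MR : 0 < M%:R :> R by rewrite ltr0n.
apply/esym/truncn_def.
have /truncn_itv/andP[h1 h2] : 0 <= M%:R * x by rewrite mulr_ge0.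
apply/andP; split.
  rewrite -(ler_pM2l MR) (le_trans _ h1)// -natrM ler_nat mulnC.
  exact: leq_trunc_div.
rewrite -(ltr_pM2l MR) (lt_le_trans h2)// -natrM ler_nat mulnC.
exact: ltn_ceil.
Qed.

End Power.

(** * Sign sums along [n ^ c] *)

Section PowerSums.
Variables (R : realType) (c : R).
Hypotheses (c_gt1 : 1 < c) (c_lt : c < 4 / 3).

Lemma sum_tm_sign_power_small (js : seq nat) (eta : R) :
  uniq js -> js != [::] -> 0 < eta ->
  exists N0, forall N, (N0 <= N)%N ->
  `|\sum_(0 <= n < N) \prod_(j <- js) tm_sign R (Num.truncn ((n + j)%:R `^ c : R))|
    <= 7 * eta * N%:R.
Proof.
move=> ujs js0 eta0.
have c1 : 0 < c - 1 by rewrite subr_gt0.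
have c0 : 0 < c by lra.
have c3 : c * 3 < 4 by rewrite -ltr_pdivlMr.
have c2 : 0 < 2 - c by lra.
have c12 : 1 <= c <= 2 by apply/andP; split; lra.
pose k0 := c * (c - 1); have k00 : 0 < k0 by rewrite mulr_gt0.
(* As [amax / kap] will equal [N / (c - 1)], this makes the near-return term exactly [eta * N]. The
   next choice, [delta], bounds the mean over residues and slopes by [eta * N] as well. *)
pose Bd := (1 + 10 / (c - 1)) / eta.
have Bd0 : 0 < Bd by rewrite divr_gt0// addr_gt0// divr_gt0.
pose delta := eta * k0 / (8 * Bd).
have delta0 : 0 < delta by apply: divr_gt0; apply: mulr_gt0.
have [Q Q0 [nu0 hQ]] := shift_average_small ujs js0 delta0.
pose D := (Q + sumn js)%N.
have js_le r j : (r < Q)%N -> j \in js -> (r + j <= D)%N.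
  move=> rQ jjs; rewrite leq_add//; first exact: ltnW.
  by rewrite sumnE (big_rem j)//= leq_addr.
have [l _ hl] := exists_pow2_ge (Bd * D%:R / eta).
have [m m0 hm] := exists_pow2_ge (Bd * D.+1%:R ^+ 2 / eta).
have M0 : 0 < (2 ^ m)%:R :> R by rewrite ltr0n expn_gt0.
have L0 : 0 < (2 ^ l)%:R :> R by rewrite ltr0n expn_gt0.
pose C1 : R := 4 * (2 ^ m)%:R * (2 ^ l)%:R + D%:R.
have C10 : 0 < C1 by rewrite ltr_wpDr// !mulr_gt0.
have etac0 : 0 < eta `^ (2 - c) by rewrite powR_gt0.
have g1 : 0 < 4 - 3 * c by lra.
have g2 : 0 < 3 - 2 * c by lra.
(* The thresholds ensure, in order: [nu0 <= nu]; windows short compared with [eta * N];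
   linearization error below 1; [kap * P <= 1]; and [1 <= eta * N]. *)
have [N1 hN1] := powR_nat_large (2 ^ nu0)%:R c1.
have [N2 hN2] := powR_nat_large (2 * C1 / eta) c2.
have [N3 hN3] := powR_nat_large ((2 ^ m)%:R * C1 ^+ 2 * k0 / eta `^ (2 - c) + 1) g1.
have [N4 hN4] := powR_nat_large ((2 ^ m)%:R * k0 * C1) g2.
have [N5 hN5] := powR_nat_large (eta^-1) ltr01.
exists (maxn 1 (maxn N1 (maxn N2 (maxn N3 (maxn N4 N5))))) => N.
rewrite !geq_max => /and5P[N_1 /hN1 E1 /hN2 E2 /hN3 E3 /andP[/hN4 E4 /hN5 E5]].
rewrite powRr1// in E5.
have NR0 : 0 < N%:R :> R by rewrite ltr0n.
have NR1 : 1 <= N%:R :> R by rewrite ler1n.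
pose y : R := N%:R `^ (c - 1); pose w : R := N%:R `^ (2 - c).
rewrite -/y in E1; rewrite -/w in E2.
have y1 : 1 <= y by rewrite /y -[leLHS](powRr0 N%:R) ler_powR// ltW.
have w0 : 0 < w by rewrite powR_gt0.
have NE s t : N%:R `^ (s + t) = N%:R `^ s * N%:R `^ t :> R.
  by rewrite powRD//; apply/implyP => _; rewrite gt_eqF.
have yw : y * w = N%:R by rewrite -NE (_ : c - 1 + (2 - c) = 1) ?powRr1//; ring.
have yz : y ^+ 2 * N%:R `^ (4 - 3 * c) = w.
  by rewrite expr2 -!NE; congr (_ `^ _); ring.
have yv : y * N%:R `^ (3 - 2 * c) = w by rewrite -NE; congr (_ `^ _); ring.
have winv : N%:R `^ (c - 2) = w^-1 by rewrite -powRN opprB.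
(* The factor 2 exceeds [c], so that [amax = 2 ^ m * c * y] is below [2 ^ (m + nu)]. *)
have [nu /andP[nu1 nu2]] : exists nu, 2 * y < (2 ^ nu)%:R <= 2 * (2 * y).
  by apply: exists_pow2_between; move: y1; clear; lra.
have nu_ge : (nu0 <= nu)%N.
  by rewrite -(leq_exp2l nu0 nu (isT : 1 < 2)%N) -(ler_nat R); move: E1 nu1 y1; clear; lra.
(* Starting near [eta * N] keeps [n ^ (c - 2)] comparable to [N ^ (c - 2)]; the initial segment is
   bounded trivially. *)
pose n0 := (Num.truncn (eta * N%:R)).+1.
have n0_gt : eta * N%:R < n0%:R by apply: truncnS_gt.
have n0_le : n0%:R <= eta * N%:R + 1.
  by rewrite -natr1 lerD2r truncn_le mulr_ge0 ?ltW.
have etaN : 1 <= eta * N%:R by move: E5; rewrite -div1r ler_pdivrMr// mulrC.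
pose f n : R := n%:R `^ c.
set g := fun n => \prod_(j <- js) tm_sign R (Num.truncn ((n + j)%:R `^ c)).
have normg n : `|g n| = 1 by apply: norm_prod_tm_sign.
have trivial_le a b : `|\sum_(a <= n < b) g n| <= (b - a)%:R.
  rewrite (le_trans (ler_norm_sum _ _ _))//; under eq_bigr do rewrite normg.
  by rewrite big_const_nat iter_addr addr0.
have [Nn0|n0N] := leqP N n0.
  rewrite (le_trans (trivial_le _ _))// subn0.
  by have : N%:R <= n0%:R :> R; [rewrite ler_nat | move: n0_le etaN; clear; lra].
rewrite (big_cat_nat (leq0n n0) (ltnW n0N))/= (le_trans (ler_normD _ _))//.
have tr0 := trivial_le 0%N n0; rewrite subn0 in tr0.
pose P := (2 ^ (m + (nu + l)))%N.
have PE : P%:R = (2 ^ m)%:R * (2 ^ nu)%:R * (2 ^ l)%:R :> R.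
  by rewrite /P !expnD !natrM mulrA.
have PDle : (P + D)%:R <= C1 * y.
  rewrite natrD PE /C1 mulrDl lerD ?ler_peMr//.
  have -> : 4 * (2 ^ m)%:R * (2 ^ l)%:R * y = (2 ^ m)%:R * (2 * (2 * y)) * (2 ^ l)%:R by ring.
  by rewrite ler_wpM2r// ler_wpM2l.
pose F n : R := (2 ^ m)%:R * f n.
pose a n : R := (2 ^ m)%:R * (c * n%:R `^ (c - 1)).
pose kap : R := (2 ^ m)%:R * (k0 / w).
have kap0 : 0 < kap by rewrite mulr_gt0// divr_gt0.
pose amax : R := (2 ^ m)%:R * (c * y).
have gE n : g n = block_sign m F js n.
  by apply: eq_bigr => j _; rewrite /floor_val /F truncn_mulr_divn ?expn_gt0// powR_ge0.
have n00 : 0 < n0%:R :> R by rewrite ltr0n.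
(* The only place where [c < 4 / 3] is sharp: a full period [P], of the order of
   [N ^ (c - 1)], is so short that the quadratic error of the linearization,
   of the order of [P ^ 2 * N ^ (c - 2)], tends to 0. *)
have gap : (2 ^ m)%:R * ((P + D)%:R ^+ 2 * (k0 * n0%:R `^ (c - 2))) < 1.
  have h1 : n0%:R `^ (c - 2) <= (eta `^ (2 - c) * w)^-1.
    rewrite -[c - 2]opprB -powRM ?(ltW eta0)// -powRN.
    by apply: powR_nonincr; rewrite ?(ltW c2) ?(ltW n0_gt) ?mulr_gt0.
  have h2 : (P + D)%:R ^+ 2 <= (C1 * y) ^+ 2 by rewrite ler_pXn2r ?nnegrE// mulr_ge0 ?ltW// (lt_le_trans _ y1).
  apply: (@le_lt_trans _ _ ((2 ^ m)%:R * ((C1 * y) ^+ 2 * (k0 * (eta `^ (2 - c) * w)^-1)))).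
    rewrite ler_wpM2l//; apply: ler_pM => //.
      by rewrite mulr_ge0 ?powR_ge0// ltW.
    by rewrite ler_wpM2l// ltW.
  have y20 : 0 < y ^+ 2 by rewrite exprn_gt0// (lt_le_trans _ y1).
  rewrite -yz; set z := _ `^ (4 - _) in E3 *.
  have z0 : 0 < z by rewrite powR_gt0.
  have -> : (2 ^ m)%:R * ((C1 * y) ^+ 2 * (k0 * (eta `^ (2 - c) * (y ^+ 2 * z))^-1)) =
     ((2 ^ m)%:R * C1 ^+ 2 * k0 / eta `^ (2 - c)) / z.
    by field; rewrite !gt_eqF// (lt_le_trans _ y1).
  by rewrite ltr_pdivrMr// mul1r (lt_le_trans _ E3)// ltrDl.
have pos n : (n0 <= n < N)%N -> 0 < n%:R :> R.
  by move=> /andP[n0n _]; rewrite (lt_le_trans n00)// ler_nat.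
have : `|\sum_(n0 <= n < N) g n| <=
    2 * (P + Q)%:R + (N%:R + 10 * amax / kap) / Bd +
    Bd * (2 / kap * delta * (2 ^ (m + nu))%:R) +
    Bd * N%:R * (D%:R / (2 ^ l)%:R + D.+1%:R ^+ 2 / (2 ^ m)%:R).
  under eq_bigr do rewrite gE.
  apply: (@sum_block_sign_le R m nu l D n0 N F a kap amax) => //.
  - by move=> n; rewrite mulr_ge0// powR_ge0.
  - move=> n u v nN nu' uv vP; have n_gt0 := pos _ nN.
    have nuR : n%:R <= u%:R :> R by rewrite ler_nat.
    have uvR : u%:R <= v%:R :> R by rewrite ler_nat.
    have /andP[t1 t2] := powR_tangent c12 n_gt0 nuR uvR.
    have -> : F v - F u - (v - u)%:R * a n =
       (2 ^ m)%:R * (f v - f u - (v%:R - u%:R) * (c * n%:R `^ (c - 1))).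
      by rewrite /F /a natrB//; ring.
    rewrite mulr_ge0//=; apply: le_lt_trans gap; rewrite ler_wpM2l//.
    apply: (le_trans t2).
    have vn : v%:R - n%:R <= (P + D)%:R :> R.
      by rewrite -natrB ?(leq_trans nu')// ler_nat leq_subLR addnA.
    have vu : v%:R - u%:R <= (P + D)%:R :> R by apply: le_trans vn; rewrite lerD2l lerN2.
    have n2 : n%:R `^ (c - 2) <= n0%:R `^ (c - 2).
      rewrite -[c - 2]opprB; apply: powR_nonincr; rewrite ?(ltW c2)// ler_nat.
      by case/andP: nN.
    have vu0 : 0 <= v%:R - u%:R :> R by rewrite subr_ge0.
    have vn0 : 0 <= v%:R - n%:R :> R by rewrite subr_ge0 (le_trans nuR).
    by rewrite ler_pM ?mulr_ge0 ?powR_ge0 ?(ltW c0) ?(ltW c1)// ?ler_pM ?powR_ge0 ?ler_wpM2l ?mulr_ge0 ?(ltW c0) ?(ltW c1)// expr2 ler_pM.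
  - move=> n nN; have : 1 <= n%:R :> R by rewrite ler1n -(ltr_nat R) pos.
    move=> n1; have p1 : 1 <= n%:R `^ (c - 1) :> R.
      by rewrite -[leLHS](powRr0 n%:R) ler_powR// ltW.
    have m2 : 2 <= (2 ^ m)%:R :> R.
      by rewrite ler_nat -{1}(expn1 2) leq_exp2l.
    have cp : 1 <= c * n%:R `^ (c - 1) by rewrite (le_trans (ltW c_gt1))// ler_peMr// ltW.
    by rewrite /a (le_trans m2)// ler_peMr.
  - move=> n nN; rewrite ler_wpM2l// ler_wpM2l ?(ltW c0)//.
    apply: ge0_ler_powR; rewrite ?nnegrE// ?ler_nat ?(ltW c1)//.
    by case/andP: nN => _ /ltnW.
  - by rewrite !mulr_ge0 ?(ltW c0)// (le_trans _ y1).
  - rewrite expnD natrM ltr_pM2l//; apply: lt_trans nu1.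
    by rewrite ltr_pM2r ?(lt_le_trans _ y1)// -subr_gt0.
  - rewrite -/P; apply: (@le_trans _ _ (kap * (C1 * y))).
      apply: ler_wpM2l (ltW kap0) _ _ _.
      by apply: le_trans PDle; rewrite ler_nat leq_addr.
    have -> : kap * (C1 * y) = (2 ^ m)%:R * k0 * C1 * y / w.
      by rewrite /kap; ring.
    rewrite ler_pdivrMr// mul1r -yv mulrC ler_wpM2l// (le_trans _ y1)//.
  - move=> n n' nN n'N nn'; rewrite /kap /a -mulrA -mulrBr ler_wpM2l//.
    rewrite natrB// -winv; apply: powR_slope => //; first exact: pos.
      by rewrite ler_nat.
    by rewrite ler_nat ltnW//; case/andP: n'N.
  by have := hQ nu m l nu_ge; rewrite -/P.
have b1 : 2 * (P + Q)%:R <= eta * N%:R.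
  apply: (@le_trans _ _ (2 * (C1 * y))).
    rewrite ler_wpM2l//; apply: le_trans PDle.
    by rewrite ler_nat leq_add2l leq_addr.
  rewrite -yw; have -> : 2 * (C1 * y) = y * (2 * C1) by ring.
  rewrite [leRHS]mulrCA ler_wpM2l ?(le_trans _ y1)//.
  by rewrite [leRHS]mulrC -ler_pdivrMr.
have b2 : (N%:R + 10 * amax / kap) / Bd = eta * N%:R.
  rewrite -yw /amax /kap /Bd /k0; field.
  by rewrite !gt_eqF// addr_gt0.
have b3 : Bd * (2 / kap * delta * (2 ^ (m + nu))%:R) <= eta * N%:R.
  rewrite expnD natrM.
  apply: (@le_trans _ _ (Bd * (2 / kap * delta * ((2 ^ m)%:R * (2 * (2 * y)))))).
    apply: ler_wpM2l (ltW Bd0) _ _ _.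
    apply: ler_wpM2l (mulr_ge0 (divr_ge0 (ler0n R 2) (ltW kap0)) (ltW delta0)) _ _ _.
    exact: ler_wpM2l.
  rewrite le_eqVlt; apply/orP; left; apply/eqP.
  by rewrite -yw /kap /delta; field; rewrite !gt_eqF.
have b4 : Bd * N%:R * (D%:R / (2 ^ l)%:R + D.+1%:R ^+ 2 / (2 ^ m)%:R) <= 2 * eta * N%:R.
  rewrite mulrAC ler_wpM2r// mulrDr.
  have q1 : Bd * (D%:R / (2 ^ l)%:R) <= eta.
    by rewrite mulrA ler_pdivrMr// [leRHS]mulrC -ler_pdivrMr.
  have q2 : Bd * (D.+1%:R ^+ 2 / (2 ^ m)%:R) <= eta.
    by rewrite mulrA ler_pdivrMr// [leRHS]mulrC -ler_pdivrMr.
  by move: q1 q2; clear; lra.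
(* The constant 7 is 2 for the terms before [n0], 1 for each of [b1], [b2], [b3], and 2 for [b4]. *)
move: b1 b2 b3 b4 tr0 n0_le etaN; clear; lra.
Qed.

End PowerSums.

(** * From sign sums to block frequencies *)

Section BlockCount.
Variable R : realType.

Lemma thue_morse_eqE n (e : 'I_2) :
  (thue_morse n == e)%:R = (1 + (-1) ^+ e * tm_sign R n) / 2.
Proof.
rewrite -val_eqE /= /tm_sign -[(-1) ^+ sum_binary_digits n]signr_odd modn2.
by case: e => -[|[|]]//= _; case: odd; rewrite /= ?expr0 ?expr1; lra.
Qed.

(** Each indicator is [(1 + (-1) ^ eps j * sign) / 2]; the subset [J] records the factors from which
    the sign is taken. *)
Lemma prod_thue_morse_eqE T (h : 'I_T -> nat) (eps : 'I_T -> 'I_2) :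
  [forall j, thue_morse (h j) == eps j]%:R =
  2 ^- T * \sum_(J : {set 'I_T}) (\prod_(j in J) (-1) ^+ eps j) *
    \prod_(j in J) tm_sign R (h j).
Proof.
have -> : [forall j, thue_morse (h j) == eps j]%:R =
    \prod_j (thue_morse (h j) == eps j)%:R :> R.
  case: forallP => [hj|/forallP]; first by rewrite big1// => j _; rewrite hj.
  rewrite negb_forall => /existsP[j /negPf hj].
  by rewrite (bigD1 j)//= hj mul0r.
under eq_bigr do rewrite thue_morse_eqE.
rewrite big_split /= prodr_const card_ord exprVn mulrC; congr (_ * _).
under eq_bigr do rewrite addrC.
rewrite bigA_distr; apply: eq_bigr => J _.
rewrite -big_split /= [RHS]big_mkcond /=.
by [].
Qed.

Lemma block_count_sum (v : nat -> nat) T (eps : 'I_T -> 'I_2) N :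
  (block_count (fun n => thue_morse (v n)) eps N)%:R =
  2 ^- T * \sum_(J : {set 'I_T}) (\prod_(j in J) (-1) ^+ eps j) *
    \sum_(1 <= n < N.+1) \prod_(j in J) tm_sign R (v (n + j)%N).
Proof.
rewrite /block_count -sum1_card natr_sum.
rewrite (eq_bigl (fun n : 'I_N.+1 => (1 <= n)%N &&
    [forall j : 'I_T, thue_morse (v (n + j)%N) == eps j])); last by move=> n; rewrite inE.
rewrite big_mkcondr /=.
rewrite -(big_mkord (fun n => 0 < n)%N (fun n =>
   if [forall j : 'I_T, thue_morse (v (n + j)%N) == eps j] then 1 else 0)).
rewrite big_mkcond big_ltn//= add0r big_nat.
under eq_bigr => n /andP[n0 _].
  rewrite n0 (_ : (if _ then _ else _) =
    [forall j : 'I_T, thue_morse (v (n + j)%N) == eps j]%:R); last by case: forallP.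
  rewrite prod_thue_morse_eqE. over.
rewrite -big_nat -mulr_sumr exchange_big /=; congr (_ * _).
by apply: eq_bigr => J _; rewrite mulr_sumr.
Qed.

End BlockCount.

Theorem theorem1 (R : realType) (c : R) (c_gt1 : 1 < c) (c_lt : c < 4 / 3) :
  normal_seq R (thue_morse_ps c).
Proof.
move=> T eps _.
pose v n := Num.truncn (n%:R `^ c : R).
pose S (J : {set 'I_T}) N := \sum_(1 <= n < N.+1) \prod_(j in J) tm_sign R (v (n + j)%N).
have normP (J : {set 'I_T}) n : `|\prod_(j in J) tm_sign R (v (n + j)%N)| = 1.
  by rewrite normr_prod big1// => j _; rewrite norm_tm_sign.
have small (J : {set 'I_T}) (e : R) : J != finset.set0 -> 0 < e ->
    exists N0, forall N, (N0 <= N)%N -> `|S J N| <= e * N%:R.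
  move=> J0 e0; pose js := map (@nat_of_ord T) (enum J).
  have ujs : uniq js by rewrite map_inj_uniq ?enum_uniq//; exact: ord_inj.
  have js0 : js != [::].
    by rewrite -size_eq0 size_map -cardE cards_eq0.
  (* Since [7 * (e / 14) = e / 2], the other half of [e] absorbs the two end terms, of modulus 1, of
     the change of range, once [4 / e <= N]. *)
  have e14 : 0 < e / 14 by rewrite divr_gt0.
  have [N0 hN0] := sum_tm_sign_power_small c_gt1 c_lt ujs js0 e14.
  exists (maxn N0 (Num.truncn (4 / e)).+1) => N.
  rewrite geq_max => /andP[/hN0 h hN].
  have hN4 : 4 / e <= N%:R.
    by apply/ltW/(lt_le_trans (truncnS_gt _)); rewrite ler_nat.
  rewrite ler_pdivrMr// in hN4.
  have gE n : \prod_(j <- js) tm_sign R (Num.truncn ((n + j)%:R `^ c : R)) =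
      \prod_(j in J) tm_sign R (v (n + j)%N).
    by rewrite big_map big_enum.
  rewrite (eq_bigr _ (fun n _ => gE n)) in h.
  have -> : S J N = \sum_(0 <= n < N) \prod_(j in J) tm_sign R (v (n + j)%N)
      - \prod_(j in J) tm_sign R (v (0 + j)%N) + \prod_(j in J) tm_sign R (v (N + j)%N).
    pose g n := \prod_(j in J) tm_sign R (v (n + j)%N).
    have : \sum_(0 <= n < N.+1) g n = \sum_(0 <= n < N) g n + g N by rewrite big_nat_recr.
    rewrite big_ltn// /S -/(g 0%N) -/(g N); clear; lra.
  rewrite (le_trans (ler_normD _ _))// normP (le_trans (lerD (ler_normB _ _) (lexx _)))//.
  rewrite normP; lra.
apply/cvgrPdist_le => e e0.
have [N0 hN0] : exists N0, forall N, (N0 <= N)%N ->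
    forall J : {set 'I_T}, J != finset.set0 -> `|S J N| <= e * N%:R.
  pose P (J : {set 'I_T}) N0 :=
    forall N, (N0 <= N)%N -> J != finset.set0 -> `|S J N| <= e * N%:R.
  have /boolp.choice[h hP] : forall J, exists N0, P J N0.
    move=> J; have [->|J0] := eqVneq J finset.set0; first by exists 0%N => N _; rewrite eqxx.
    by have [N0 hN0] := small J e J0 e0; exists N0 => N /hN0.
  exists (\max_J h J) => N hN J; apply: hP; apply: leq_trans hN.
  exact: leq_bigmax.
near=> N.
have N0N : (N0 <= N)%N by near: N; exact: nbhs_infty_ge.
have Npos : (0 < N)%N by near: N; exact: nbhs_infty_gt.
have NR : 0 < N%:R :> R by rewrite ltr0n.
rewrite (block_count_sum R v eps N).
(* The empty set gives the main term, [N] before the factor [2 ^- T]. *)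
rewrite (bigD1 finset.set0)//= big_set0 mul1r.
have -> : \sum_(1 <= n < N.+1) \prod_(j in (finset.set0 : {set 'I_T})) tm_sign R (v (n + j)%N) = N%:R.
  under eq_bigr do rewrite big_set0.
  by rewrite big_const_nat iter_addr addr0 subSS subn0.
pose E (J : {set 'I_T}) : R := (\prod_(j in J) (-1) ^+ eps j) * S J N.
rewrite (eq_bigr E)//.
(* The number of subsets, [2 ^ T], cancels the factor [2 ^- T], so the final error is exactly
   [e]. *)
have Ele : `|\sum_(J | J != finset.set0) E J| <= (2 ^ T)%:R * (e * N%:R).
  rewrite (le_trans (ler_norm_sum _ _ _))//.
  apply: (@le_trans _ _ (\sum_(J : {set 'I_T}) e * N%:R)).
    rewrite big_mkcond /=; apply: ler_sum => J _.
    case: ifP => [J0|_]; last by rewrite mulr_ge0 ?(ltW e0).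
    rewrite /E normrM normr_prod big1 ?mul1r => [|j _]; last first.
      by rewrite normrX normrN1 expr1n.
    exact: hN0.
  have cardS : #|{set 'I_T}| = (2 ^ T)%N.
    have -> : (2 ^ T = #|powerset [set: 'I_T]|)%N by rewrite card_powerset cardsT card_ord.
    apply/esym/eq_card => J.
    by rewrite powersetE finset.subsetT.
  by rewrite sumr_const cardS mulr_natl.
set Y := \sum_(J | _) _ in Ele *.
have -> : 2 ^- T - 2 ^- T * (N%:R + Y) / N%:R = - (2 ^- T * (Y / N%:R)) :> R.
  by field; rewrite gt_eqF//= expf_neq0.
rewrite normrN normrM normrM ger0_norm ?invr_ge0 ?exprn_ge0//.
rewrite mulrC ler_pdivrMr ?exprn_gt0// (ger0_norm (x := N%:R^-1)) ?invr_ge0//.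
by rewrite ler_pdivrMr// mulrAC mulrC -natrX.
Unshelve. all: by end_near.
Qed.
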